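(* For each $n$ suppose we observe $y\sim\mathrm{N}_n(\theta_0,\mathrm{I}_n)$, and the normal means model $y_i=\theta_i+\epsilon_i$, $\epsilon_i\sim\mathrm{N}(0,1)$ independently, $1\le i\le n$, is fitted with the prior on $\theta=(\theta_1,\dots,\theta_n)$ given by $\theta_j\mid\tau\sim\mathrm{N}(0,\tau)$ independently for $j=1,\dots,n$ (a global-local prior with all local scales $\psi_j=1$), where the global parameter $\tau$ has density $f\in\mathcal{F}$. Assume $\theta_0\in l_0[q_n;n]$ where $q_n/n\to0$ and $\|\theta_0\|_2>s_n$, with $s_n^2=q_n\log(n/q_n)$. Then $$\mathbb{E}_{n,\theta_0}\,\mathbb{P}(\|\theta-\theta_0\|_2\le s_n\mid y)\to0\quad\text{as } n\to\infty.$$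
   Context: $\|\cdot\|_2$ is the Euclidean norm; $\mathrm{N}(0,v)$ is the normal distribution with variance $v$. $\theta_0=\theta_0^{(n)}\in\mathbb{R}^n$ is a sequence of true parameters, and $l_0[q;n]=\{\theta\in\mathbb{R}^n:\#\{1\le j\le n:\theta_j\ne0\}\le q\}$. The class $\mathcal{F}$ consists of the probability densities $f$ on $(0,\infty)$ for which there is a constant $M>0$ with (i) $f(\tau)\le M$ for all $\tau\in(0,\infty)$, and (ii) $f(\tau)>1/M$ for all $\tau\in(0,1)$; $f$ does not depend on $n$. $\mathbb{P}(\cdot\mid y)$ is the posterior distribution of $\theta$ given $y$ under the fitted model and prior, and $\mathbb{E}_{n,\theta_0}$ is expectation over $y\sim\mathrm{N}_n(\theta_0,\mathrm{I}_n)$. The quantity $s_n^2$ is the minimax squared error loss rate over $l_0[q_n;n]$. *)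

(* Defs.v *)
From HB Require Import structures.
From mathcomp Require Import all_boot all_order all_algebra.
From mathcomp Require Import all_classical all_reals all_analysis.

Set Implicit Arguments.
Unset Strict Implicit.
Unset Printing Implicit Defensive.

Import Order.TTheory GRing.Theory Num.Theory.
Import numFieldNormedType.Exports.

Local Open Scope classical_set_scope.
Local Open Scope ring_scope.

(* R^n is [n.-tuple (measurableTypeR R)]: the sigma-algebra which the library
   puts on tuples is the one generated by the coordinates, i.e. the Borel
   sigma-algebra of R^n. *)
Notation vec R n := (n.-tuple (measurableTypeR R)).

Section product_probability.
Context {R : realType}.

Definition cons_vec n (x : measurableTypeR R * vec R n) : vec R n.+1 :=
  [the n.+1.-tuple _ of x.1 :: x.2].

Lemma measurable_cons_vec n :
  measurable_fun [set: measurableTypeR R * vec R n] (@cons_vec n).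
Proof. exact: measurable_cons. Qed.

HB.instance Definition _ n :=
  isMeasurableFun.Build _ _ _ _ (@cons_vec n) (@measurable_cons_vec n).

(* Law of a random vector with independent coordinates, the i-th one of law P i *)
Fixpoint product_prob (n : nat) :
    ('I_n -> probability (measurableTypeR R) R) -> probability (vec R n) R :=
  match n with
  | 0 => fun _ => \d_([tuple] : vec R 0)
  | m.+1 => fun P =>
      distribution (P ord0 \x product_prob (fun i => P (lift ord0 i)))%E
                   (@cons_vec m : {mfun _ >-> vec R m.+1})
  end.

Lemma product_prob_rect n (P : 'I_n -> probability (measurableTypeR R) R)
    (A : 'I_n -> set (measurableTypeR R)) :
  (forall i, measurable (A i)) ->
  product_prob P [set t | forall i, A i (tnth t i)] = (\prod_(i < n) P i (A i))%E.
Proof.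
elim: n P A => [|n IH] P A mA.
  by rewrite big_ord0 /= /dirac indicE mem_set// => -[].
rewrite big_ord_recl -IH//= /distribution /pushforward.
rewrite -product_measure1E//; last first.
  rewrite (_ : [set _ | _] =
      \bigcap_(i in [set: 'I_n]) [set t | A (lift ord0 i) (tnth t i)]).
    apply: fin_bigcap_measurable => // i _; rewrite -[X in measurable X]setTI.
    by apply: measurable_tnth => //; exact: mA.
  by apply/seteqP; split=> [t tA i _|t tA i]; exact: tA.
congr (_ _); apply/seteqP; split=> -[x t] /= => [xtA|[xA tA] i].
  split=> [|i]; first exact: (xtA ord0).
  by have := xtA (lift ord0 i); rewrite /cons_vec tnthS.
by case: (unliftP ord0 i) => [j ->|->] //; rewrite /cons_vec tnthS; exact: tA.
Qed.

End product_probability.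

Section normal_means.
Context {R : realType}.

Definition norm2 n (x : vec R n) : R := Num.sqrt (\sum_(i < n) tnth x i ^+ 2).

Definition subvec n (x y : vec R n) : vec R n :=
  [tuple tnth x i - tnth y i | i < n].

Definition zerovec n : vec R n := [tuple 0 | _ < n].

Definition l0 (q : R) (n : nat) : set (vec R n) :=
  [set theta | #|[pred j : 'I_n | tnth theta j != 0]|%:R <= q].

(* N_n(mu, v I_n).  The scale argument of [normal_prob] is the standard
   deviation, whereas v is the variance. *)
Definition normal_vec n (mu : vec R n) (v : R) : probability (vec R n) R :=
  product_prob (fun i => normal_prob (tnth mu i) (Num.sqrt v)).

Definition is_density_pos (f : R -> R) : Prop :=
  [/\ measurable_fun (`]0, +oo[ : set R) f,
      forall t, 0 < t -> 0 <= f t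
    & (\int[lebesgue_measure]_(t in `]0%R, +oo[) (f t)%:E = 1)%E].

Definition classF (f : R -> R) : Prop :=
  is_density_pos f /\
  exists2 M : R, 0 < M &
    (forall t, 0 < t -> f t <= M) /\ (forall t, 0 < t < 1 -> M^-1 < f t).

(* Density of N_n(theta, I_n) at y *)
Definition likelihood n (y theta : vec R n) : R :=
  \prod_(i < n) normal_pdf (tnth theta i) 1 (tnth y i).

(* Integral of the likelihood over B against the prior
     tau ~ f,  theta | tau ~ N_n(0, tau I_n). *)
Definition prior_lik n (f : R -> R) (y : vec R n) (B : set (vec R n)) : \bar R :=
  (\int[lebesgue_measure]_(tau in `]0%R, +oo[)
     ((f tau)%:E *
      \int[normal_vec (zerovec n) tau]_(theta in B) (likelihood y theta)%:E))%E.

(* P(theta \in B | y), by Bayes' formula; numerator and denominator are at most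
   the supremum of the likelihood, hence finite. *)
Definition posterior n (f : R -> R) (y : vec R n) (B : set (vec R n)) : R :=
  fine (prior_lik f y B) / fine (prior_lik f y setT).

Definition srate (q : R) (n : nat) : R := Num.sqrt (q * ln (n%:R / q)).

End normal_means.

Arguments l0 {R} q n.

(* Main.v *)
(* Given tau, the law of y is N_n(0, (1 + tau) I_n), so the posterior of tau has
   density proportional to f(tau) times the explicit function [evidence y tau].
   With n = p^8, a Chernoff bound gives |y|^2 >= n - p^5 with high probability,
   and then [evidence y] is nondecreasing up to the factor e on [0, p^-5]; as f is
   bounded above, and below near 0, the posterior mass of tau <= p^-6 is O(1/p).
   For tau >= p^-6 a Chernoff bound for |theta - theta_0|^2 under the posterior
   given tau shows that the ball has mass at most exp(- p^2 / 16): since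
   |theta_0| > s_n, and since <y, theta_0> is not much larger than |theta_0|^2, the
   shrunk posterior mean is not closer to theta_0 than about s_n, while the
   posterior spread contributes about n tau >= p^2 to the squared distance.
   All exponential moments factorise over the coordinates into one-dimensional
   Gaussian integrals. *)
Require Import Defs.
From mathcomp Require Import all_boot all_order all_algebra.
From mathcomp Require Import all_classical all_reals all_analysis.
From mathcomp Require Import measurable_realfun ring lra.

Set Implicit Arguments.
Unset Strict Implicit.
Unset Printing Implicit Defensive.

Import Order.TTheory GRing.Theory Num.Theory.
Import numFieldNormedType.Exports.

Local Open Scope classical_set_scope.
Local Open Scope ring_scope.

(** * Monotonicity of nonnegative integrals *)

Section nonmeasurable_monotonicity.
Local Open Scope ereal_scope.
Context d (T : measurableType d) (R : realType).
Variable mu : {measure set T -> \bar R}.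

(* The integral of a nonnegative function is a supremum over the simple
   functions below it, hence monotone even without measurability. *)
Lemma ge0_le_integral_nonmeasurable (D : set T) (f g : T -> \bar R) :
  (forall x, D x -> 0 <= f x) -> (forall x, D x -> f x <= g x) ->
  \int[mu]_(x in D) f x <= \int[mu]_(x in D) g x.
Proof.
move=> f0 fg; have g0 x : D x -> 0 <= g x.
  by move=> Dx; exact: le_trans (f0 _ Dx) (fg _ Dx).
rewrite !ge0_integralE//; apply: ge_ereal_sup => _ /= [h hf <-].
apply: ereal_sup_ubound => /=; exists h => // x; apply: le_trans (hf x) _.
by rewrite !patchE; case: ifPn => // /set_mem; exact: fg.
Qed.

End nonmeasurable_monotonicity.

(** * One-dimensional Gaussian integrals *)

Section gaussian.
Context {R : realType}.
Implicit Types a b c m s v x y : R.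

(** The Radon-Nikodym derivative of the normal law and [normal_pdf] have the same integral over
    every measurable set, so they agree almost everywhere and one may replace the other under the
    integral. *)
Lemma ge0_integral_normal_prob m s (f : R -> \bar R) :
  measurable_fun [set: R] f -> (forall x, 0 <= f x)%E ->
  (\int[normal_prob m s]_x f x =
   \int[lebesgue_measure]_x (f x * (normal_pdf m s x)%:E))%E.
Proof.
move=> mf f0; have nmu := normal_prob_dominates m s.
rewrite -(Radon_Nikodym_SigmaFinite.change_of_variables nmu)//.
have iRN := Radon_Nikodym_SigmaFinite.f_integrable nmu.
have mRN := measurable_int _ iRN.
have mpdf : measurable_fun [set: R] (fun x => (normal_pdf m s x)%:E).
  by apply/measurable_EFinP; exact: measurable_normal_pdf.
apply: ae_eq_integral => //; try exact: emeasurable_funM.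
apply: ae_eqe_mul2l; apply: integral_ae_eq => //= A AE mA.
by rewrite -Radon_Nikodym_SigmaFinite.f_integral.
Qed.

Lemma measurable_expR_quadratic a b c :
  measurable_fun [set: R] (fun x => expR (- a * x ^+ 2 + b * x + c)).
Proof.
apply: measurableT_comp => //; apply: measurable_funD => //.
by apply: measurable_funD; apply: measurable_funM => //; exact: measurable_funX.
Qed.

(* Completing the square: up to a factor, the integrand is the density of
   N((m + b v) / (1 + 2 a v), v / (1 + 2 a v)). *)
Lemma integral_normal_expR_quadratic a b c m v : 0 < v -> 0 < 1 + 2 * a * v ->
  (\int[normal_prob m (Num.sqrt v)]_x (expR (- a * x ^+ 2 + b * x + c))%:E =
   (expR (c + (b ^+ 2 * v / 2 + b * m - a * m ^+ 2) / (1 + 2 * a * v)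
     - ln (1 + 2 * a * v) / 2))%:E)%E.
Proof.
move=> v0 w0; set w := 1 + 2 * a * v.
rewrite ge0_integral_normal_prob; last 2 first.
- by apply/measurable_EFinP; exact: measurable_expR_quadratic.
- by move=> x; rewrite lee_fin expR_ge0.
set K := expR _; pose m' := (m + b * v) / w; pose s' := Num.sqrt (v / w).
have vw0 : 0 < v / w by rewrite divr_gt0.
have sv0 : Num.sqrt v != 0 by rewrite gt_eqF// sqrtr_gt0.
have s'0 : s' != 0 by rewrite gt_eqF// sqrtr_gt0.
transitivity (\int[lebesgue_measure]_x (K%:E * (normal_pdf m' s' x)%:E))%E; last first.
  rewrite ge0_integralZl_EFin//.
  - by rewrite integral_normal_pdf mule1.
  - by move=> x _; rewrite lee_fin normal_pdf_ge0.
  - by apply/measurable_EFinP; exact: measurable_normal_pdf.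
  - exact: expR_ge0.
apply: eq_integral => x _; rewrite -!EFinM; congr EFin.
rewrite !normal_pdfE// /normal_peak /normal_fun !sqr_sqrtr ?ltW//.
rewrite mulrCA -expRD [RHS]mulrCA -expRD.
(* The normalising constants differ by sqrt(w), written as exp(ln w / 2) so that it cancels the term
   - ln w / 2 of [K]. *)
have -> : (Num.sqrt (v / w * pi *+ 2))^-1 =
    (Num.sqrt (v * pi *+ 2))^-1 * expR (ln w / 2).
  have -> : v / w * pi *+ 2 = (v * pi *+ 2) / w.
    by rewrite mulrnAl mulrAC.
  rewrite sqrtrM ?mulrn_wge0 ?mulr_ge0 ?pi_ge0 ?(ltW v0)// invfM sqrtrV ?ltW// invrK.
  by rewrite -[in LHS](lnK (w0 : w \is Num.pos)) {1}(splitr (ln w)) expRD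
     -expr2 sqrtr_sqr ger0_norm ?expR_ge0.
rewrite -[RHS]mulrA -expRD; congr (_ * expR _).
have wn : w != 0 by rewrite gt_eqF.
have vn : v != 0 by rewrite gt_eqF.
(* Eliminating [a] makes [w] a free nonzero variable, and the comparison of exponents becomes a
   rational identity. *)
have -> : a = (w - 1) / (2 * v) by rewrite /w; field.
rewrite /m' /K; move: (ln w) => L; move: w wn {K m' vw0 s' s'0 w0} => w wn.
by field; rewrite vn wn.
Qed.

End gaussian.

(** * Integrals of product functions against a product law *)

Section product.
Context {R : realType}.

Lemma measurable_prod_tnth n (h : 'I_n -> R -> R) :
  (forall i, measurable_fun [set: R] (h i)) ->
  measurable_fun [set: vec R n] (fun t => \prod_(i < n) h i (tnth t i)).
Proof.
move=> mh; apply: measurable_prod => i _.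
by apply: measurableT_comp; [exact: mh|exact: measurable_tnth].
Qed.

(** Induction on [n]: transport along [cons_vec] and Tonelli split off the first coordinate. *)
Lemma integral_product_prob n (P : 'I_n -> probability (measurableTypeR R) R)
    (h : 'I_n -> R -> R) (c : 'I_n -> R) :
  (forall i, measurable_fun [set: R] (h i)) -> (forall i x, 0 <= h i x) ->
  (forall i, (\int[P i]_x (h i x)%:E = (c i)%:E)%E) ->
  (\int[product_prob P]_t (\prod_(i < n) h i (tnth t i))%:E =
   (\prod_(i < n) c i)%:E)%E.
Proof.
elim: n P h c => [|n IH] P h c mh h0 hc.
  rewrite /= integral_dirac//= ?diracT ?mul1e ?big_ord0//.
  by under eq_fun do rewrite big_ord0; exact: measurable_cst.
have p0 m (u : 'I_m -> R -> R) t : (forall i x, 0 <= u i x) ->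
  (0 <= (\prod_(i < m) u i (tnth t i))%:E :> \bar R)%E.
  by move=> u0; rewrite lee_fin prodr_ge0.
rewrite [product_prob P]/=.
rewrite ge0_integral_distribution; last 2 first.
- by apply/measurable_EFinP; exact: measurable_prod_tnth.
- by move=> t; exact: p0.
rewrite fubini_tonelli1/=; last 2 first.
- apply/measurable_EFinP; 
  exact: (measurableT_comp (measurable_prod_tnth mh) (@measurable_cons_vec R n)).
- by move=> t; exact: p0.
rewrite /fubini_F/=.
transitivity (\int[P ord0]_x
   ((\prod_(i < n) c (lift ord0 i))%:E * (h ord0 x)%:E))%E; last first.
  rewrite ge0_integralZl//=.
  - by rewrite hc -EFinM big_ord_recl mulrC.
  - by apply/measurable_EFinP; exact: mh.
  - by move=> x _; rewrite lee_fin.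
  - rewrite lee_fin prodr_ge0// => i _; rewrite -lee_fin -hc integral_ge0// => x _.
    by rewrite lee_fin.
apply: eq_integral => x _.
rewrite -(IH (fun i => P (lift ord0 i)) (fun i => h (lift ord0 i)))//.
rewrite muleC -ge0_integralZl//=.
- apply: eq_integral => t _; rewrite -EFinM big_ord_recl; congr (_ * _)%:E.
  by apply: eq_bigr => i _; rewrite /cons_vec tnthS.
- apply/measurable_EFinP.
  exact: (measurable_prod_tnth (fun i => mh (lift ord0 i))).
- by move=> t _; rewrite lee_fin prodr_ge0.
- by rewrite lee_fin.
Qed.

End product.

(** * Gaussian integrals on R^n, the evidence, and the ball given tau *)

Section normal_vec_integrals.
Context {R : realType}.

Lemma integral_normal_vec_expR_quadratic n (mu : vec R n) (a v : R)
    (b : 'I_n -> R) (c : R) : 0 < v -> 0 < 1 + 2 * a * v ->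
  (\int[normal_vec mu v]_t
     (expR (- a * (\sum_(i < n) tnth t i ^+ 2) + \sum_(i < n) b i * tnth t i + c))%:E =
   (expR (c + (v / 2 * (\sum_(i < n) b i ^+ 2) + \sum_(i < n) b i * tnth mu i
       - a * \sum_(i < n) tnth mu i ^+ 2) / (1 + 2 * a * v)
     - n%:R / 2 * ln (1 + 2 * a * v)))%:E)%E.
Proof.
move=> v0 w0; set w := 1 + 2 * a * v.
(* The constant [c] is shared equally among the coordinates, hence the separate case n = 0. *)
pose h i x := expR (- a * x ^+ 2 + b i * x + c / n%:R).
pose k i := expR (c / n%:R +
  (b i ^+ 2 * v / 2 + b i * tnth mu i - a * tnth mu i ^+ 2) / w - ln w / 2).
have [n0|n0] := eqVneq n 0%N.
  have E (F : 'I_n -> R) : \sum_(i < n) F i = 0.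
    by apply: big1 => i _; have := ltn_ord i; rewrite {2}n0.
  under eq_integral do rewrite !E.
  rewrite !E integral_cst//= probability_setT mule1 n0.
  by congr (expR _)%:E; ring.
have nn : n%:R != 0 :> R by rewrite pnatr_eq0.
transitivity (\int[normal_vec mu v]_t (\prod_(i < n) h i (tnth t i))%:E)%E.
  apply: eq_integral => t _; rewrite -expR_sum !big_split/= -mulr_sumr.
  by rewrite sumr_const card_ord -(mulr_natr (c / _)) divfK.
rewrite (@integral_product_prob _ _ _ h k).
- rewrite -expR_sum !big_split/= sumr_const card_ord -(mulr_natr (c / _)) divfK//.
  rewrite sumr_const card_ord -(mulr_natr (- _)) -mulr_suml !big_split/=.
  rewrite sumrN -mulr_sumr.
  have -> : \sum_(i < n) b i ^+ 2 * v / 2 = v / 2 * \sum_(i < n) b i ^+ 2.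
    by rewrite mulr_sumr; apply: eq_bigr => i _; rewrite -mulrA mulrC.
  by have -> : - (ln w / 2) * n%:R = - (n%:R / 2 * ln w) by move: (ln w) => L; ring.
- by move=> i; exact: measurable_expR_quadratic.
- by move=> i x; exact: expR_ge0.
- by move=> i; rewrite /h integral_normal_expR_quadratic.
Qed.

Lemma measurable_expR_quadratic_vec n (a c : R) (b : 'I_n -> R) :
  measurable_fun [set: vec R n] (fun t : vec R n =>
    expR (- a * (\sum_(i < n) tnth t i ^+ 2) + \sum_(i < n) b i * tnth t i + c)).
Proof.
have mt (i : 'I_n) : measurable_fun [set: vec R n] (fun t : vec R n => tnth t i : R).
  exact: measurable_tnth.
apply: measurableT_comp => //; apply: measurable_funD => //.
apply: measurable_funD.
  by apply: measurable_funM => //; apply: measurable_sum => i; exact: measurable_funX.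
by apply: measurable_sum => i; exact: measurable_funM.
Qed.

Lemma likelihoodE n (y t : vec R n) : likelihood y t =
  normal_peak 1 ^+ n * expR (- 2^-1 * (\sum_(i < n) tnth t i ^+ 2)
    + \sum_(i < n) tnth y i * tnth t i - 2^-1 * \sum_(i < n) tnth y i ^+ 2).
Proof.
rewrite /likelihood; under eq_bigr => i _.
  rewrite normal_pdfE ?oner_neq0// /normal_fun; over.
rewrite big_split/= prodr_const card_ord; congr (_ * _).
rewrite -expR_sum; congr expR; rewrite !mulr_sumr -sumrN -!big_split/=.
by apply: eq_bigr => i _; field.
Qed.

Lemma likelihood_ge0 n (y t : vec R n) : 0 <= likelihood y t.
Proof. by apply: prodr_ge0 => i _; exact: normal_pdf_ge0. Qed.

Lemma sqr_norm2 n (x : vec R n) : norm2 x ^+ 2 = \sum_(i < n) tnth x i ^+ 2.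
Proof. by rewrite /norm2 sqr_sqrtr// sumr_ge0// => i _; exact: sqr_ge0. Qed.

Lemma sqr_norm2_subvec n (x y : vec R n) : norm2 (subvec x y) ^+ 2 =
  norm2 x ^+ 2 - 2 * (\sum_(i < n) tnth y i * tnth x i) + norm2 y ^+ 2.
Proof.
rewrite !sqr_norm2 mulr_sumr -sumrN -!big_split/=; apply: eq_bigr => i _.
by rewrite tnth_mktuple; ring.
Qed.

(* Marginal density of N_n(0, (1 + tau) I_n), the law of y given tau. *)
Definition evidence n (y : vec R n) (tau : R) : R :=
  normal_peak 1 ^+ n *
  expR (- (norm2 y ^+ 2 / (2 * (1 + tau))) - n%:R / 2 * ln (1 + tau)).

Lemma evidence_ge0 n (y : vec R n) tau : 0 <= evidence y tau.
Proof. by rewrite mulr_ge0 ?expR_ge0// exprn_ge0// normal_peak_ge0. Qed.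

Lemma evidence_gt0 n (y : vec R n) tau : 0 < evidence y tau.
Proof. by rewrite mulr_gt0 ?expR_gt0// exprn_gt0// normal_peak_gt0// oner_neq0. Qed.

Lemma integral_likelihood n (y : vec R n) tau : 0 < tau ->
  (\int[normal_vec (zerovec n) tau]_t (likelihood y t)%:E = (evidence y tau)%:E)%E.
Proof.
move=> t0; under eq_integral do rewrite likelihoodE EFinM.
rewrite ge0_integralZl//; last 2 first.
- by apply/measurable_EFinP; exact: measurable_expR_quadratic_vec.
- by rewrite lee_fin exprn_ge0// normal_peak_ge0.
rewrite integral_normal_vec_expR_quadratic//; last by lra.
rewrite -EFinM /evidence sqr_norm2; congr (_ * expR _)%:E.
rewrite (_ : \sum_(i < n) tnth y i * _ = 0); last first.
  by rewrite big1// => i _; rewrite tnth_mktuple mulr0.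
rewrite (_ : \sum_(i < n) tnth (zerovec n) i ^+ 2 = 0); last first.
  by rewrite big1// => i _; rewrite tnth_mktuple expr0n.
have -> : 1 + 2 * 2^-1 * tau = 1 + tau by lra.
by field; lra.
Qed.

(** Chernoff bound: the indicator of the ball is at most exp((s^2 - |t - x|^2) / 2). Its product
    with the likelihood is again Gaussian in [t], with quadratic coefficient 1 and linear
    coefficient y + x, whence the factors 1 + 2 tau. *)
Lemma integral_likelihood_ball n (y x : vec R n) s tau : 0 < tau -> 0 <= s ->
  (\int[normal_vec (zerovec n) tau]_(t in [set t : vec R n | (norm2 (subvec t x) <= s)%R])
     (likelihood y t)%:E <=
   (normal_peak 1 ^+ n * expR (s ^+ 2 / 2 - (norm2 y ^+ 2 + norm2 x ^+ 2) / 2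
     + tau * (norm2 y ^+ 2 + 2 * (\sum_(i < n) tnth y i * tnth x i) + norm2 x ^+ 2)
         / (2 * (1 + 2 * tau))
     - n%:R / 2 * ln (1 + 2 * tau)))%:E)%E.
Proof.
move=> t0 s0; rewrite integral_mkcond.
pose c := s ^+ 2 / 2 - (norm2 y ^+ 2 + norm2 x ^+ 2) / 2.
pose b i := tnth y i + tnth x i.
pose E (t : vec R n) :=
  expR (- 1 * (\sum_(i < n) tnth t i ^+ 2) + \sum_(i < n) b i * tnth t i + c).
have p0 : 0 <= normal_peak 1 ^+ n :> R by rewrite exprn_ge0// normal_peak_ge0.
have -> : (normal_peak 1 ^+ n * expR (s ^+ 2 / 2 - (norm2 y ^+ 2 + norm2 x ^+ 2) / 2
     + tau * (norm2 y ^+ 2 + 2 * (\sum_(i < n) tnth y i * tnth x i) + norm2 x ^+ 2)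
         / (2 * (1 + 2 * tau)) - n%:R / 2 * ln (1 + 2 * tau)))%:E =
    (\int[normal_vec (zerovec n) tau]_t ((normal_peak 1 ^+ n)%:E * (E t)%:E))%E.
  rewrite ge0_integralZl//; last 2 first.
  - by apply/measurable_EFinP; exact: measurable_expR_quadratic_vec.
  - by move=> t _; rewrite lee_fin expR_ge0.
  rewrite integral_normal_vec_expR_quadratic//; last by lra.
  rewrite -EFinM; congr (_ * expR _)%:E.
  rewrite (_ : \sum_(i < n) b i * _ = 0); last first.
    by rewrite big1// => i _; rewrite tnth_mktuple mulr0.
  rewrite (_ : \sum_(i < n) tnth (zerovec n) i ^+ 2 = 0); last first.
    by rewrite big1// => i _; rewrite tnth_mktuple expr0n.
  have -> : \sum_(i < n) b i ^+ 2 =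
      norm2 y ^+ 2 + 2 * (\sum_(i < n) tnth y i * tnth x i) + norm2 x ^+ 2.
    rewrite !sqr_norm2 mulr_sumr -!big_split/=.
    by apply: eq_bigr => i _; rewrite /b; ring.
  have -> : 1 + 2 * 1 * tau = 1 + 2 * tau by lra.
  by rewrite /c; field; lra.
apply: ge0_le_integral_nonmeasurable => t _.
  by rewrite patchE; case: ifP => // _; rewrite lee_fin likelihood_ge0.
rewrite patchE; case: ifPn => [|_]; last first.
  by rewrite -EFinM lee_fin mulr_ge0// expR_ge0.
move=> /set_mem/= ts; rewrite -EFinM lee_fin likelihoodE ler_wpM2l// ler_expR.
have : norm2 (subvec t x) ^+ 2 <= s ^+ 2.
  by rewrite lerXn2r// ?nnegrE// sqrtr_ge0.
rewrite sqr_norm2_subvec -!sqr_norm2 /b.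
under [in X in _ -> _ <= X]eq_bigr do rewrite mulrDl.
by rewrite big_split/= /c; lra.
Qed.

End normal_vec_integrals.

(** * Elementary inequalities between exponents *)

Section exponents.
Context {R : realType}.
Implicit Types n s rho Y W t x : R.

(** Tangent line of ln at 1 + t. The order of [t] and [t'] is left free: taking t' below t bounds
    the growth of the logarithm from below. *)
Lemma ln_ratio_le t t' : 0 <= t -> 0 <= t' ->
  ln (1 + t') - ln (1 + t) <= (t' - t) / (1 + t).
Proof.
move=> t0 t'0; have p : 0 < 1 + t by lra.
have p' : 0 < 1 + t' by lra.
rewrite -ln_div//.
have -> : (1 + t') / (1 + t) = 1 + (t' - t) / (1 + t) by field; lra.
by rewrite le_ln1Dx// ltr_pdivlMr//; lra.
Qed.

(** Here [Y] stands for |y|^2. Going from t to t' loses at most (t' - t)(n t' + x) / (2 (1 + t)(1 +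
    t')), and the last two hypotheses give t' (n t' + x) <= 2. *)
Lemma evidence_exponent_mono n x t t' Y : 0 <= n -> 0 <= x -> 0 <= t -> t <= t' ->
  n - x <= Y -> t' * x <= 1 -> n * t' ^+ 2 <= 1 ->
  - (Y / (2 * (1 + t))) - n / 2 * ln (1 + t) <=
  1 + (- (Y / (2 * (1 + t'))) - n / 2 * ln (1 + t')).
Proof.
move=> n0 x0 t0 tt' YX tx nt.
have p : 0 < 1 + t by lra.
have p' : 0 < 1 + t' by lra.
have L : ln (1 + t') - ln (1 + t) <= (t' - t) / (1 + t) by apply: ln_ratio_le; lra.
set l := ln (1 + t) in L *; set l' := ln (1 + t') in L *.
have H1 : n / 2 * (l' - l) <= n / 2 * ((t' - t) / (1 + t)) by rewrite ler_wpM2l//; lra.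
have H2 : (n - x) * ((t' - t) / (2 * (1 + t) * (1 + t'))) <=
          Y / (2 * (1 + t)) - Y / (2 * (1 + t')).
  have -> : Y / (2 * (1 + t)) - Y / (2 * (1 + t')) =
      Y * ((t' - t) / (2 * (1 + t) * (1 + t'))) by field; lra.
  by rewrite ler_wpM2r// divr_ge0//; [lra | rewrite mulr_ge0//; lra].
have H3 : n / 2 * ((t' - t) / (1 + t)) - (n - x) * ((t' - t) / (2 * (1 + t) * (1 + t')))
    <= 1.
  have -> : n / 2 * ((t' - t) / (1 + t)) - (n - x) * ((t' - t) / (2 * (1 + t) * (1 + t')))
    = ((t' - t) * (n * t' + x)) / (2 * ((1 + t) * (1 + t'))) by field; lra.
  have q : 1 <= (1 + t) * (1 + t') by nra.
  rewrite ler_pdivrMr; last lra.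
  have : (t' - t) * (n * t' + x) <= t' * (n * t' + x).
    by rewrite ler_wpM2r//; [rewrite addr_ge0// mulr_ge0//; lra | lra].
  rewrite expr2 in nt; nra.
lra.
Qed.

(* The exponent of [integral_likelihood_ball] minus that of [evidence], with
   s, rho, Y for squared norms and W for the inner product of y and theta_0. For
   t >= 1/2 the negative quadratic form in (y, theta_0) is dropped and the
   logarithm beats s; for t < 1/2, s <= rho cancels the terms of order 0 in t. *)
Lemma ball_exponent_le n s rho Y W t t1 : 0 <= n -> 0 <= Y -> s <= rho -> s <= n / 16 ->
  W <= 3 / 2 * rho + n / 16 ->
  0 <= t ^+ 2 * Y - 2 * t * (1 + t) * W + (1 + t) ^+ 2 * rho ->
  0 < t1 -> t1 <= 1 / 2 -> t1 <= t ->
  s / 2 - (Y + rho) / 2 + t * (Y + 2 * W + rho) / (2 * (1 + 2 * t))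
    - n / 2 * ln (1 + 2 * t) <=
  - (Y / (2 * (1 + t))) - n / 2 * ln (1 + t) - n * t1 / 16.
Proof.
move=> n0 Y0 srho sn Wle Q t10 t12 t1t.
have t0 : 0 < t by lra.
have p : 0 < 1 + t by lra.
have p2 : 0 < 1 + 2 * t by lra.
have L : ln (1 + t) - ln (1 + 2 * t) <= (t - 2 * t) / (1 + 2 * t).
  by apply: ln_ratio_le; lra.
set l := ln (1 + t) in L *; set l' := ln (1 + 2 * t) in L *.
have H1 : n / 2 * (l - l') <= n / 2 * ((t - 2 * t) / (1 + 2 * t)).
  by rewrite ler_wpM2l//; lra.
suff : s / 2 - (Y + rho) / 2 + t * (Y + 2 * W + rho) / (2 * (1 + 2 * t))
    + Y / (2 * (1 + t)) + n / 2 * ((t - 2 * t) / (1 + 2 * t)) <= - (n * t1 / 16) by lra.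
have [tlt|tge] := ltP t (1 / 2).
- have -> : s / 2 - (Y + rho) / 2 + t * (Y + 2 * W + rho) / (2 * (1 + 2 * t))
    + Y / (2 * (1 + t)) + n / 2 * ((t - 2 * t) / (1 + 2 * t)) =
    (s * (1 + 2 * t) - t ^+ 2 * Y / (1 + t) + 2 * t * W - (1 + t) * rho - n * t)
    / (2 * (1 + 2 * t)) by field; lra.
  rewrite ler_pdivrMr; last lra.
  (* With [W] replaced by its bound, the terms in s and rho add up to (1 - 2t)(s - rho) + 4ts. As
     4ts <= nt / 4, at most - 5nt / 8 remains, while - nt1 / 4 would suffice. *)
  have h1 : 0 <= t ^+ 2 * Y / (1 + t) by rewrite divr_ge0 ?mulr_ge0 ?sqr_ge0//; lra.
  have h2 : t * W <= t * (3 / 2 * rho + n / 16) by rewrite ler_wpM2l//; lra.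
  have h3 : 0 <= (1 - 2 * t) * (rho - s) by rewrite mulr_ge0//; lra.
  have h4 : 0 <= t * (n / 16 - s) by rewrite mulr_ge0//; lra.
  have h5 : 0 <= n * (t - t1) by rewrite mulr_ge0//; lra.
  have h6 : 0 <= n * t1 * (1 / 2 - t) by rewrite mulr_ge0// ?mulr_ge0//; lra.
  have h7 : 0 <= n * t1 by rewrite mulr_ge0//; lra.
  nra.
- have -> : s / 2 - (Y + rho) / 2 + t * (Y + 2 * W + rho) / (2 * (1 + 2 * t))
    + Y / (2 * (1 + t)) + n / 2 * ((t - 2 * t) / (1 + 2 * t)) =
    (s * (1 + 2 * t) - (t ^+ 2 * Y - 2 * t * (1 + t) * W + (1 + t) ^+ 2 * rho) / (1 + t)
      - n * t) / (2 * (1 + 2 * t)) by field; lra.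
  rewrite ler_pdivrMr; last lra.
  set q := _ / (1 + t).
  have h1 : 0 <= q by rewrite divr_ge0//; lra.
  have h2 : s * (1 + 2 * t) <= n / 16 * (1 + 2 * t) by rewrite ler_wpM2r//; lra.
  have h3 : n * t1 * (1 + 2 * t) <= n * (1 / 2) * (1 + 2 * t).
    by rewrite ler_wpM2r ?ler_wpM2l//; lra.
  have h4 : 0 <= n * (t - 1 / 2) by rewrite mulr_ge0//; lra.
  nra.
Qed.

End exponents.

(** * Posterior bounds for fixed data y *)

Section posterior_bounds.
Context {R : realType}.
Local Notation mu := (@lebesgue_measure R).

Lemma fine_le_EFin (x : \bar R) (r : R) :
  (0 <= x)%E -> (x <= r%:E)%E -> fine x <= r.
Proof. by case: x => //= x _; rewrite lee_fin. Qed.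

Lemma measurable_evidence n (y : vec R n) :
  measurable_fun (`]0, +oo[%classic : set R) (evidence y).
Proof.
(* The reciprocal of 2 (1 + t) is rewritten through exp and ln, whose measurability composes; the
   two functions agree for t > 0. *)
pose g (t : R) := normal_peak 1 ^+ n *
  expR (- (norm2 y ^+ 2 * expR (- ln (2 * (1 + t)))) - n%:R / 2 * ln (1 + t)).
apply: (@eq_measurable_fun _ _ _ _ _ g).
  move=> t /[!inE]/=; rewrite in_itv/= andbT => t0; rewrite /g /evidence.
  by rewrite expRN lnK// posrE; lra.
apply: measurable_funTS; apply: measurable_funM => //.
have m1 : measurable_fun [set: R] (fun t : R => 1 + t) by exact: measurable_funD.
have m2 : measurable_fun [set: R] (fun t : R => ln (2 * (1 + t))).
  have m2 : measurable_fun [set: R] (fun t : R => 2 * (1 + t)).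
    exact: measurable_funM.
  exact: (measurableT_comp (@measurable_ln R) m2).
have m3 : measurable_fun [set: R] (fun t : R => expR (- ln (2 * (1 + t)))).
  by apply: measurableT_comp => //; exact: measurableT_comp.
apply: measurableT_comp => //; apply: measurable_funB.
  by apply: measurableT_comp => //; exact: measurable_funM.
by apply: measurable_funM => //; exact: (measurableT_comp (@measurable_ln R) m1).
Qed.

Lemma evidence_le_peak n (y : vec R n) t : 0 <= t -> evidence y t <= normal_peak 1 ^+ n.
Proof.
move=> t0; rewrite ler_piMr ?exprn_ge0 ?normal_peak_ge0//.
rewrite -[leRHS]expR0 ler_expR subr_le0.
have h1 : 0 <= norm2 y ^+ 2 / (2 * (1 + t)).
  by rewrite divr_ge0 ?sqr_ge0//; lra.
have h2 : 0 <= n%:R / 2 * ln (1 + t).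
  by rewrite mulr_ge0 ?divr_ge0// ln_ge0//; lra.
by rewrite (le_trans _ h2)// oppr_le0.
Qed.

Lemma integral_likelihood_le n (y : vec R n) (B : set (vec R n)) t : 0 < t ->
  (\int[normal_vec (zerovec n) t]_(u in B) (likelihood y u)%:E <= (evidence y t)%:E)%E.
Proof.
move=> t0; rewrite -integral_likelihood// integral_mkcond.
apply: ge0_le_integral_nonmeasurable => u _; rewrite patchE; case: ifP => // _;
  by rewrite lee_fin likelihood_ge0.
Qed.

Variable f : R -> R.
Hypothesis f_density : is_density_pos f.

Let f_ge0 t : 0 < t -> 0 <= f t.
Proof. by case: f_density => _ + _; exact. Qed.

Let measurable_f_evidence n (y : vec R n) :
  measurable_fun (`]0%R, +oo[%classic : set R) (fun t => (f t * evidence y t)%:E).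
Proof.
case: f_density => mf _ _.
by apply/measurable_EFinP/measurable_funM => //; exact: measurable_evidence.
Qed.

Let prior_lik_ge0 n (y : vec R n) (B : set (vec R n)) : (0 <= prior_lik f y B)%E.
Proof.
apply: integral_ge0 => t /=; rewrite in_itv/= andbT => t0.
rewrite mule_ge0 ?lee_fin ?f_ge0//; apply: integral_ge0 => u _.
by rewrite lee_fin likelihood_ge0.
Qed.

Lemma prior_lik_setT n (y : vec R n) : prior_lik f y setT =
  (\int[mu]_(t in `]0%R, +oo[) (f t * evidence y t)%:E)%E.
Proof.
apply: eq_integral => t /[!inE]/=; rewrite in_itv/= andbT => t0.
by rewrite integral_likelihood.
Qed.

(** The evidence is at most [normal_peak 1 ^+ n] and f integrates to 1. Finiteness ensures that
    [fine] loses nothing in the denominator of [posterior]. *)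
Lemma prior_lik_setT_fin_num n (y : vec R n) : prior_lik f y setT \is a fin_num.
Proof.
rewrite ge0_fin_numE//.
apply: (@le_lt_trans _ _ (normal_peak 1 ^+ n : R)%:E); last exact: ltry.
have p0 : 0 <= normal_peak 1 ^+ n :> R by rewrite exprn_ge0// normal_peak_ge0.
case: f_density => mf _ intf.
rewrite -[leRHS]mule1 -intf -ge0_integralZl//; last 2 first.
- by apply/measurable_EFinP.
- by move=> t /=; rewrite in_itv/= andbT => t0; rewrite lee_fin f_ge0.
rewrite prior_lik_setT; apply: ge0_le_integral_nonmeasurable => t /=;
  rewrite in_itv/= andbT => t0.
  by rewrite lee_fin mulr_ge0 ?f_ge0// evidence_ge0.
by rewrite -EFinM lee_fin mulrC ler_wpM2r ?f_ge0// evidence_le_peak// ltW.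
Qed.

Lemma prior_lik_le_setT n (y : vec R n) (B : set (vec R n)) :
  (prior_lik f y B <= prior_lik f y setT)%E.
Proof.
apply: ge0_le_integral_nonmeasurable => t /=; rewrite in_itv/= andbT => t0.
  rewrite mule_ge0 ?lee_fin ?f_ge0//; apply: integral_ge0 => u _.
  by rewrite lee_fin likelihood_ge0.
rewrite lee_wpmul2l ?lee_fin ?f_ge0// integral_likelihood//.
exact: integral_likelihood_le.
Qed.

Lemma posterior_ge0 n (y : vec R n) (B : set (vec R n)) : 0 <= posterior f y B.
Proof. by rewrite divr_ge0// fine_ge0. Qed.

Lemma posterior_le1 n (y : vec R n) (B : set (vec R n)) : posterior f y B <= 1.
Proof.
have := prior_lik_setT_fin_num y; have := prior_lik_le_setT y B.
have := prior_lik_ge0 y B; rewrite /posterior.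
move: (prior_lik f y B) (prior_lik f y setT) => N Z N0 NZ Zfin.
(* A quotient by 0 is 0 by convention, so the bound survives a vanishing denominator. *)
have [->|z0] := eqVneq (fine Z) 0; first by rewrite invr0 mulr0.
have Z0 : (0 <= Z)%E by exact: le_trans NZ.
have zpos : 0 < fine Z by rewrite lt_neqAle eq_sym z0 fine_ge0.
rewrite ler_pdivrMr// mul1r fine_le// ge0_fin_numE//.
by rewrite (le_lt_trans NZ)// -ge0_fin_numE.
Qed.

Variable M : R.
Hypothesis M_gt0 : 0 < M.
Hypothesis f_le : forall t, 0 < t -> f t <= M.
Hypothesis f_gt : forall t, 0 < t < 1 -> M^-1 < f t.

(** Only the window ]t1, t2[ is kept: it lies in (0, 1), where f > 1 / M, and the evidence there is
    at least [evidence y t1 / e]. *)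
Lemma prior_lik_setT_ge n (y : vec R n) (t1 t2 e : R) :
  0 < t1 -> t1 < t2 -> t2 <= 1 -> 0 < e ->
  (forall t, t1 <= t <= t2 -> evidence y t1 <= e * evidence y t) ->
  (t2 - t1) * evidence y t1 / (M * e) <= fine (prior_lik f y setT).
Proof.
move=> t10 t12 t21 e0 H.
rewrite -lee_fin fineK ?prior_lik_setT_fin_num// prior_lik_setT.
apply: (@le_trans _ _ (\int[mu]_(t in `]t1, t2[) (f t * evidence y t)%:E)%E); last first.
  apply: ge0_subset_integral => //.
  - exact: measurable_f_evidence.
  - move=> t /=; rewrite in_itv/= andbT => t0.
    by rewrite lee_fin mulr_ge0 ?f_ge0 ?evidence_ge0.
  - by apply: subset_itv; rewrite bnd_simp// ltW.
apply: (@le_trans _ _ (\int[mu]_(t in `]t1, t2[) (M^-1 * (evidence y t1 / e))%:E)%E).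
  rewrite integral_cst//= lebesgue_measure_itv/= lte_fin t12 -EFinD -EFinM lee_fin.
  by rewrite le_eqVlt; apply/orP; left; apply/eqP; rewrite invfM; ring.
apply: ge0_le_integral_nonmeasurable => t /=; rewrite in_itv/= => /andP[tt1 tt2].
  by rewrite lee_fin mulr_ge0 ?invr_ge0 ?divr_ge0 ?evidence_ge0// ltW.
rewrite lee_fin ler_pM ?invr_ge0 ?divr_ge0 ?evidence_ge0 ?(ltW M_gt0) ?(ltW e0)//.
  by rewrite ltW// f_gt//; lra.
by rewrite ler_pdivrMr// mulrC H// !ltW.
Qed.

(** Below [t1] the ball is ignored and f <= M is used; above [t1] the ball costs a factor [d]
    relative to the evidence, whose total integral is the denominator. *)
Lemma prior_lik_le n (y : vec R n) (B : set (vec R n)) (t1 e d : R) :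
  0 < t1 -> 0 < e -> 0 <= d ->
  (forall t, 0 < t <= t1 -> evidence y t <= e * evidence y t1) ->
  (forall t, t1 <= t -> (\int[normal_vec (zerovec n) t]_(u in B) (likelihood y u)%:E
      <= (d * evidence y t)%:E)%E) ->
  fine (prior_lik f y B) <= M * e * evidence y t1 * t1 + d * fine (prior_lik f y setT).
Proof.
move=> t10 e0 d0 H1 H2.
have Zfin := prior_lik_setT_fin_num y.
have c0 : 0 <= M * e * evidence y t1.
  by rewrite mulr_ge0 ?evidence_ge0// mulr_ge0// ltW.
suff N_le : (prior_lik f y B <=
    (M * e * evidence y t1 * t1 + d * fine (prior_lik f y setT))%:E)%E.
  exact: fine_le_EFin (prior_lik_ge0 y B) N_le.
rewrite EFinD [in leRHS]EFinM [X in (_ <= _ + X)%E]EFinM fineK// prior_lik_setT.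
(* The length [t1] becomes the integral of an indicator, so that both summands form one integral and
   the comparison is pointwise in t. *)
have -> : ((M * e * evidence y t1)%:E * t1%:E =
    (M * e * evidence y t1)%:E * \int[mu]_(t in `]0%R, +oo[) (\1_`]0%R, t1] t)%:E)%E.
  congr (_ * _)%E; rewrite integral_indic//.
  rewrite (_ : `]0, t1]%classic `&` `]0, +oo[%classic = `]0, t1]%classic); last first.
    apply/setIidPl; exact: subset_itvl.
  by rewrite /= lebesgue_measure_itv/= lte_fin t10 oppr0 adde0.
have mi : measurable_fun (`]0, +oo[%classic : set R)
    (fun t => (\1_(`]0, t1]%classic) t : R)%:E).
  by apply/measurable_EFinP; exact: measurable_indic.
have fe0 t : `]0, +oo[%classic t -> (0 <= (f t * evidence y t)%:E)%E.
  by rewrite /= in_itv/= andbT => t0; rewrite lee_fin mulr_ge0 ?f_ge0 ?evidence_ge0.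
rewrite -ge0_integralZl//.
rewrite -[X in (_ <= _ + X)%E]ge0_integralZl//; last exact: measurable_f_evidence.
rewrite -ge0_integralD//; last 4 first.
- by move=> t _; rewrite mule_ge0// lee_fin indicE.
- exact: measurable_funeM.
- by move=> t t0; rewrite mule_ge0//; exact: fe0.
- by apply: measurable_funeM; exact: measurable_f_evidence.
apply: ge0_le_integral_nonmeasurable => t /=; rewrite in_itv/= andbT => t0.
  rewrite mule_ge0 ?lee_fin ?f_ge0//; apply: integral_ge0 => u _.
  by rewrite lee_fin likelihood_ge0.
have ft0 := f_ge0 t0; have ev0 := evidence_ge0 y t.
rewrite -!EFinM -EFinD.
have [tt1|t1t] := leP t t1.
  apply: (@le_trans _ _ ((f t)%:E * (evidence y t)%:E)%E).
    by rewrite lee_wpmul2l ?lee_fin//; exact: integral_likelihood_le.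
  rewrite indicE mem_set/= ?in_itv/= ?t0// mulr1 -EFinM lee_fin.
  apply: (@le_trans _ _ (M * (e * evidence y t1))).
    by rewrite ler_pM ?f_le ?H1 ?t0.
  by rewrite [leLHS]mulrA lerDl; apply: mulr_ge0 => //; apply: mulr_ge0.
apply: (@le_trans _ _ ((f t)%:E * (d * evidence y t)%:E)%E).
  by rewrite lee_wpmul2l ?lee_fin//; apply: H2; exact: ltW.
by rewrite -EFinM lee_fin mulrCA lerDr mulr_ge0// indicE.
Qed.

(** Numerator and denominator each contribute a factor M e, and [evidence y t1] cancels in the
    quotient. *)
Lemma posterior_le n (y : vec R n) (B : set (vec R n)) (t1 t2 e d : R) :
  0 < t1 -> t1 < t2 -> t2 <= 1 -> 0 < e -> 0 <= d ->
  (forall t, 0 < t <= t1 -> evidence y t <= e * evidence y t1) ->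
  (forall t, t1 <= t <= t2 -> evidence y t1 <= e * evidence y t) ->
  (forall t, t1 <= t -> (\int[normal_vec (zerovec n) t]_(u in B) (likelihood y u)%:E
      <= (d * evidence y t)%:E)%E) ->
  posterior f y B <= (M * e) ^+ 2 * (t1 / (t2 - t1)) + d.
Proof.
move=> t10 t12 t21 e0 d0 H1 H2 H3.
have zge := prior_lik_setT_ge t10 t12 t21 e0 H2.
have nle := prior_lik_le t10 e0 d0 H1 H3.
have ev0 := evidence_gt0 y t1.
have t120 : 0 < t2 - t1 by rewrite subr_gt0.
have Me0 : 0 < M * e by rewrite mulr_gt0.
have z0 : 0 < fine (prior_lik f y setT).
  by rewrite (lt_le_trans _ zge)// divr_gt0// mulr_gt0.
rewrite /posterior ler_pdivrMr// mulrDl (le_trans nle)// lerD2r.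
have -> : M * e * evidence y t1 * t1 = (M * e) ^+ 2 * (t1 / (t2 - t1)) *
    ((t2 - t1) * evidence y t1 / (M * e)).
  by field; rewrite !gt_eqF.
by rewrite ler_wpM2l// mulr_ge0 ?sqr_ge0// divr_ge0// ltW.
Qed.

Lemma posterior_ball_le n (p : R) (y x : vec R n) (s : R) : 2 <= p -> p ^+ 8 = n%:R ->
  0 <= s -> s <= norm2 x -> s ^+ 2 <= n%:R / 16 ->
  n%:R - p ^+ 5 <= norm2 y ^+ 2 ->
  \sum_(i < n) tnth y i * tnth x i <= 3 / 2 * norm2 x ^+ 2 + n%:R / 16 ->
  posterior f y [set t : vec R n | (norm2 (subvec t x) <= s)%R] <=
  (M * expR 1) ^+ 2 / (p - 1) + expR (- (p ^+ 2 / 16)).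
Proof.
move=> p2 pn s0 sx sn Yge Wle; have p0 : 0 < p by lra.
have pk k : 0 < p ^+ k by rewrite exprn_gt0.
have pk1 k : 1 <= p ^+ k by rewrite exprn_ege1//; lra.
have n0 : 0 <= n%:R :> R by [].
(* These scales give t1 / (t2 - t1) = 1 / (p - 1) and n t1 = p^2. At t2 both p^5 t2 = 1 and n t2^2 =
   p^-2 <= 1, so the evidence is monotone up to the factor e. *)
pose t1 := (p ^+ 6)^-1; pose t2 := (p ^+ 5)^-1.
have t10 : 0 < t1 by rewrite invr_gt0.
have t21 : t2 <= 1 by rewrite invf_le1.
have t12 : t1 < t2.
  by rewrite ltf_pV2 ?posrE// (exprS _ 5) ltr_pMl//; lra.
have t1half : t1 <= 1 / 2.
  rewrite div1r lef_pV2 ?posrE//.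
  by rewrite (exprS _ 5) (le_trans p2)// ler_peMr// ltW.
have mono t t' : 0 <= t -> t <= t' -> t' <= t2 ->
    evidence y t <= expR 1 * evidence y t'.
  move=> t0 tt' t't2; rewrite mulrCA ler_wpM2l ?exprn_ge0 ?normal_peak_ge0//.
  rewrite -expRD ler_expR; apply: (@evidence_exponent_mono _ _ (p ^+ 5)) => //.
  - exact: ltW.
  - by rewrite -ler_pdivlMr// div1r.
  - apply: (@le_trans _ _ (p ^+ 8 * t2 ^+ 2)).
      by rewrite pn ler_wpM2l// lerXn2r ?nnegrE//; [exact: le_trans tt'|exact/ltW/(lt_trans t10)].
    rewrite exprVn -exprM.
    by rewrite ler_pdivrMr// mul1r ler_weXn2l//; lra.
have -> : (M * expR 1) ^+ 2 / (p - 1) = (M * expR 1) ^+ 2 * (t1 / (t2 - t1)).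
  rewrite /t1 /t2; congr (_ * _); field.
  by rewrite !gt_eqF//; lra.
apply: posterior_le => //.
- by move=> t /andP[t0 tt1]; apply: mono => //; exact: ltW.
- by move=> t /andP[t1t tt2]; apply: mono => //; exact: ltW.
move=> t t1t; have t0 : 0 < t by exact: lt_le_trans t1t.
apply: le_trans (integral_likelihood_ball _ _ t0 s0) _.
rewrite lee_fin mulrCA ler_wpM2l ?exprn_ge0 ?normal_peak_ge0// -expRD ler_expR.
rewrite [leRHS]addrC.
have -> : p ^+ 2 / 16 = n%:R * t1 / 16.
  by rewrite -pn /t1; field; rewrite gt_eqF.
apply: ball_exponent_le => //.
- exact: sqr_ge0.
- by rewrite lerXn2r// nnegrE (le_trans s0).
(* The remaining quadratic form is |t y - (1 + t) x|^2, summed coordinatewise. *)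
rewrite !sqr_norm2 !mulr_sumr -sumrN -!big_split/= sumr_ge0// => i _.
have -> : t ^+ 2 * tnth y i ^+ 2 - 2 * t * (1 + t) * (tnth y i * tnth x i) +
  (1 + t) ^+ 2 * tnth x i ^+ 2 = (t * tnth y i - (1 + t) * tnth x i) ^+ 2 by ring.
exact: sqr_ge0.
Qed.

End posterior_bounds.

(** * Expectation over the data y *)

Section expected_posterior.
Context {R : realType}.

Lemma expR_oppr_le (u v : R) : 0 < v -> v <= u -> expR (- u) <= v^-1.
Proof.
move=> v0 vu; have u0 : 0 < u by exact: lt_le_trans vu.
rewrite expRN lef_pV2 ?posrE ?expR_gt0//.
by have := expR_ge1Dx u; lra.
Qed.

(** With l = 1 / (4 p^3) and ln(1 + 2l) >= 2l (1 - 2l), the exponent is at most - p^5 l + 2 n l^2 =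
    - p^2 / 8; this l minimises that bound. A nonzero mean only lowers the expectation. *)
Lemma expectation_small_norm_le n (p : R) (x : vec R n) : 0 < p -> p ^+ 8 = n%:R ->
  (\int[normal_vec x 1]_y
     (expR ((n%:R - p ^+ 5 - norm2 y ^+ 2) / (4 * p ^+ 3)))%:E <=
   (expR (- (p ^+ 2 / 8)))%:E)%E.
Proof.
move=> p0 pn; have pk k : 0 < p ^+ k by rewrite exprn_gt0.
have [l l0 lE] : exists2 l : R, 0 < l & l = (4 * p ^+ 3)^-1.
  by exists (4 * p ^+ 3)^-1 => //; rewrite invr_gt0 mulr_gt0.
pose c := (n%:R - p ^+ 5) * l.
have -> : (fun y : vec R n => (expR ((n%:R - p ^+ 5 - norm2 y ^+ 2) / (4 * p ^+ 3)))%:E) =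
    (fun y => (expR (- l * (\sum_(i < n) tnth y i ^+ 2)
      + \sum_(i < n) 0 * tnth y i + c))%:E).
  apply/funext => y; congr (expR _)%:E; rewrite sqr_norm2 -mulr_sumr mul0r /c -lE.
  ring.
rewrite integral_normal_vec_expR_quadratic//; last by lra.
have -> : \sum_(i < n) 0 * tnth x i = 0 by rewrite big1// => i _; rewrite mul0r.
have -> : \sum_(i < n) 0 ^+ 2 = 0 :> R by rewrite big1// => i _; rewrite expr0n.
rewrite lee_fin ler_expR mulr0 !add0r mulr1 -sqr_norm2.
have L : ln (1 + 0) - ln (1 + 2 * l) <= (0 - 2 * l) / (1 + 2 * l).
  by apply: ln_ratio_le; lra.
rewrite addr0 ln1 sub0r in L.
have h1 : 0 <= l * norm2 x ^+ 2 / (1 + 2 * l).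
  apply: divr_ge0; last lra.
  by apply: mulr_ge0; [exact: ltW|exact: sqr_ge0].
have h2 : n%:R / 2 * (- ln (1 + 2 * l)) <= n%:R / 2 * ((0 - 2 * l) / (1 + 2 * l)).
  by rewrite ler_wpM2l.
have h3 : (0 - 2 * l) / (1 + 2 * l) <= - (2 * l) * (1 - 2 * l).
  rewrite ler_pdivrMr; last lra.
  have := sqr_ge0 l; nra.
have h4 : n%:R / 2 * ((0 - 2 * l) / (1 + 2 * l)) <= n%:R / 2 * (- (2 * l) * (1 - 2 * l)).
  by rewrite ler_wpM2l.
have -> : - (p ^+ 2 / 8) = c + n%:R / 2 * (- (2 * l) * (1 - 2 * l)).
  by rewrite /c lE -pn; field; lra.
lra.
Qed.

(** The inner product has law N(|x|^2, |x|^2), so its exponential has mean exp(3/2 |x|^2), which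
    explains the threshold. The general formula is applied with a = 0. *)
Lemma expectation_large_inner_le n (x : vec R n) :
  (\int[normal_vec x 1]_y
     (expR (\sum_(i < n) tnth y i * tnth x i - (3 / 2 * norm2 x ^+ 2 + n%:R / 16)))%:E =
   (expR (- (n%:R / 16)))%:E)%E.
Proof.
pose c := - (3 / 2 * norm2 x ^+ 2 + n%:R / 16).
have E0 (A B C : R) : - 0 * A + B + C = B + C by ring.
have -> : (fun y : vec R n => (expR (\sum_(i < n) tnth y i * tnth x i -
    (3 / 2 * norm2 x ^+ 2 + n%:R / 16)))%:E) =
    (fun y => (expR (- 0 * (\sum_(i < n) tnth y i ^+ 2)
      + \sum_(i < n) tnth x i * tnth y i + c))%:E).
  apply/funext => y; rewrite E0.
  by under eq_bigr do rewrite mulrC.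
have w0 : 0 < 1 + 2 * 0 * 1 :> R by lra.
rewrite integral_normal_vec_expR_quadratic//.
have -> : \sum_(i < n) tnth x i * tnth x i = norm2 x ^+ 2.
  by rewrite sqr_norm2; apply: eq_bigr => i _; rewrite expr2.
have -> : 1 + 2 * 0 * 1 = 1 :> R by ring.
rewrite ln1 /c; congr (_%:E); congr expR; move: (norm2 x) => r.
by field.
Qed.

Lemma expectation_posterior_ball_le (f : R -> R) (M : R) n (p s : R) (x : vec R n) :
  is_density_pos f -> 0 < M -> (forall t, 0 < t -> f t <= M) ->
  (forall t, 0 < t < 1 -> M^-1 < f t) ->
  2 <= p -> p ^+ 8 = n%:R -> 0 <= s -> s <= norm2 x -> s ^+ 2 <= n%:R / 16 ->
  (\int[normal_vec x 1]_y
     (posterior f y [set t : vec R n | (norm2 (subvec t x) <= s)%R])%:E <=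
   (((M * expR 1) ^+ 2 + 48) / (p - 1))%:E)%E.
Proof.
move=> fd M0 fM fm p2 pn s0 sx sn; have p0 : 0 < p by lra.
have pk k : 0 < p ^+ k by rewrite exprn_gt0.
have n0 : 0 <= n%:R :> R by [].
set eta := (M * expR 1) ^+ 2 / (p - 1) + expR (- (p ^+ 2 / 16)).
have eta0 : 0 <= eta.
  by rewrite addr_ge0 ?expR_ge0// divr_ge0 ?sqr_ge0//; lra.
pose g1 (y : vec R n) := expR ((n%:R - p ^+ 5 - norm2 y ^+ 2) / (4 * p ^+ 3)).
pose g2 (y : vec R n) :=
  expR (\sum_(i < n) tnth y i * tnth x i - (3 / 2 * norm2 x ^+ 2 + n%:R / 16)).
have mt (i : 'I_n) :
    measurable_fun [set: vec R n] (fun y : vec R n => tnth y i : R).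
  exact: measurable_tnth.
have mg1 : measurable_fun [set: vec R n] (fun y => (g1 y)%:E).
  apply/measurable_EFinP; rewrite /g1.
  under eq_fun do rewrite sqr_norm2.
  apply: measurableT_comp => //; apply: measurable_funM => //.
  apply: measurable_funB => //; apply: measurable_sum => i.
  by apply: measurable_funX; exact: mt.
have mg2 : measurable_fun [set: vec R n] (fun y => (g2 y)%:E).
  apply/measurable_EFinP; apply: measurableT_comp => //.
  apply: measurable_funB => //; apply: measurable_sum => i.
  by apply: measurable_funM => //; exact: mt.
(* Each of [g1], [g2] is at least 1 on its exceptional event, where the posterior is bounded by 1;
   elsewhere [eta] bounds it. *)
apply: (@le_trans _ _ (\int[normal_vec x 1]_y (eta%:E + ((g1 y)%:E + (g2 y)%:E)))%E).
  apply: ge0_le_integral_nonmeasurable => y _; first by rewrite lee_fin posterior_ge0.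
  rewrite -!EFinD lee_fin.
  have p1 := posterior_le1 fd y [set t : vec R n | (norm2 (subvec t x) <= s)%R].
  have g10 : 0 <= g1 y by exact: expR_ge0.
  have g20 : 0 <= g2 y by exact: expR_ge0.
  have [Y|Y] := leP (n%:R - p ^+ 5) (norm2 y ^+ 2); last first.
    apply: (le_trans p1); suff : 1 <= g1 y by lra.
    rewrite -[leLHS]expR0 ler_expR divr_ge0//; first by rewrite subr_ge0 ltW.
    by rewrite mulr_ge0// ltW.
  have [W|W] := leP (\sum_(i < n) tnth y i * tnth x i)
      (3 / 2 * norm2 x ^+ 2 + n%:R / 16); last first.
    apply: (le_trans p1); suff : 1 <= g2 y by lra.
    by rewrite -[leLHS]expR0 ler_expR subr_ge0 ltW.
  apply: (le_trans (posterior_ball_le fd M0 fM fm p2 pn s0 sx sn Y W)).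
  by rewrite lerDl addr_ge0.
rewrite ge0_integralD//; last 2 first.
- by move=> y _; rewrite -EFinD lee_fin addr_ge0// expR_ge0.
- exact: emeasurable_funD.
rewrite integral_cst//= probability_setT mule1.
rewrite ge0_integralD//; last 2 first.
- by move=> y _; rewrite lee_fin expR_ge0.
- by move=> y _; rewrite lee_fin expR_ge0.
have := expectation_small_norm_le x p0 pn => h1.
apply: (@le_trans _ _ (eta%:E + ((expR (- (p ^+ 2 / 8)))%:E + (expR (- (n%:R / 16)))%:E))%E).
  by rewrite leeD2l// expectation_large_inner_le leeD2r.
rewrite -!EFinD lee_fin.
have b1 : 0 < (p - 1) / 16 by lra.
have p2p : p <= p ^+ 2 by rewrite expr2; nra.
have p7 : 1 <= p ^+ 7 by rewrite exprn_ege1//; lra.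
have p8p : p <= p ^+ 8 by rewrite (exprS _ 7) ler_peMr// ltW.
(* All three exponents exceed (p - 1) / 16 in size, so each exponential is at most 16 / (p - 1);
   this is the source of 48. *)
have e1 : expR (- (p ^+ 2 / 16)) <= ((p - 1) / 16)^-1 by apply: expR_oppr_le; lra.
have e2 : expR (- (p ^+ 2 / 8)) <= ((p - 1) / 16)^-1 by apply: expR_oppr_le; lra.
have e3 : expR (- (n%:R / 16)) <= ((p - 1) / 16)^-1.
  by apply: expR_oppr_le; rewrite // -pn; lra.
have -> : ((M * expR 1) ^+ 2 + 48) / (p - 1) = (M * expR 1) ^+ 2 / (p - 1) +
    3 * ((p - 1) / 16)^-1 by field; lra.
rewrite /eta; lra.
Qed.

(** With w = sqrt(n / q), the claim reads 2 q ln w <= q w^2 / 16. Since ln w <= w, it is enough that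
    w >= 32, and 1024 = 32^2. *)
Lemma sqr_srate_le (q : R) n : (0 < n)%N -> 0 <= q -> q / n%:R <= 1 / 1024 ->
  srate q n ^+ 2 <= n%:R / 16.
Proof.
move=> n0 q0 qn; have nn0 : 0 < n%:R :> R by rewrite ltr0n.
(* This case includes q = 0; the square root of a nonpositive number is 0. *)
have [q_le0|qpos] := leP (q * ln (n%:R / q)) 0.
  by rewrite /srate ler0_sqrtr// expr0n/=; lra.
rewrite /srate sqr_sqrtr; last exact: ltW.
have q_gt0 : 0 < q.
  by rewrite lt_neqAle q0 andbT; apply: contraTneq qpos => <-; rewrite mul0r ltxx.
pose w := Num.sqrt (n%:R / q).
have w0 : 0 < w by rewrite sqrtr_gt0 divr_gt0.
have w2 : w ^+ 2 = n%:R / q by rewrite sqr_sqrtr// divr_ge0// ltW.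
have wge : 32 <= w.
  rewrite -(@ler_pXn2r _ 2)// ?nnegrE ?(ltW w0)// w2 ler_pdivlMr//.
  by move: qn; rewrite ler_pdivrMr//; lra.
have -> : ln (n%:R / q) = 2 * ln w by rewrite -w2 lnXn// mulr_natl.
have lw : ln w <= w by rewrite ltW// ln_sublinear.
have -> : n%:R = q * w ^+ 2 by rewrite w2 mulrC divfK// gt_eqF.
rewrite -[leRHS]mulrA ler_wpM2l//.
by rewrite expr2; nra.
Qed.

End expected_posterior.

(** * Passage to the limit in n *)

Theorem theorem3p6 (R : realType) (f : R -> R) (q : nat -> R)
    (theta0 : forall n : nat, vec R n) :
  classF f ->
  (forall n, (0 < n)%N -> theta0 n \in l0 (q n) n) ->
  q n / n%:R @[n --> \oo] --> (0 : R) ->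
  (forall n, (0 < n)%N -> srate (q n) n < norm2 (theta0 n)) ->
  ('E_(normal_vec (theta0 n) 1)[fun y : vec R n =>
      posterior f y
        [set theta : vec R n |
          (norm2 (subvec theta (theta0 n)) <= srate (q n) n)%R]])%E
    @[n --> \oo] --> (0 : \bar R)%E.
Proof.
move=> [fd [M M0 [fM fm]]] th0 qn0 s_lt.
(* The real eighth root of n, so that p^8 = n holds exactly for every n. *)
pose p n : R := Num.sqrt (Num.sqrt (Num.sqrt n%:R)).
have p8 n : p n ^+ 8 = n%:R.
  by rewrite (exprM _ 2 4) (exprM _ 2 2) !sqr_sqrtr ?sqrtr_ge0.
pose K := (M * expR 1) ^+ 2 + 48.
have K0 : 0 < K by rewrite /K; have := sqr_ge0 (M * expR 1); lra.
have p_large (A : R) : 0 <= A -> \forall n \near \oo, A <= p n.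
  move=> A0; near=> n; rewrite -(@ler_pXn2r _ 8)// ?nnegrE ?sqrtr_ge0// p8.
  by near: n; exact: nbhs_infty_ger.
have q_small : \forall n \near \oo, q n / n%:R <= 1 / 1024.
  have e0 : 0 < 1 / 1024 :> R by lra.
  move/cvgrPdist_le : qn0 => /(_ _ e0); apply: filterS => n.
  by rewrite sub0r normrN; apply: le_trans; exact: ler_norm.
apply: (@squeeze_cvge _ _ _ _ (cst 0%E) _ (fun n => (K / (p n - 1))%:E)).
- near=> n; rewrite expectation.unlock; apply/andP; split.
    by apply: integral_ge0 => y _; rewrite lee_fin posterior_ge0.
  have n0 : (0 < n)%N by near: n; exact: nbhs_infty_gt.
  (* Nonnegative because q n bounds the number of nonzero coordinates of [theta0 n]. *)
  have q0 : 0 <= q n by have := th0 n n0; rewrite inE /l0/=; exact: le_trans.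
  have qn : q n / n%:R <= 1 / 1024 by near: n; exact: q_small.
  apply: (@expectation_posterior_ball_le _ _ M _ (p n)) => //.
  + by near: n; apply: p_large.
  + exact: sqrtr_ge0.
  + by rewrite ltW// s_lt.
  + exact: sqr_srate_le.
- exact: cvg_cst.
- apply/cvg_EFin; first by near=> n.
  apply/cvgrPdist_le => e e0; near=> n.
  have pn : 1 + K / e <= p n.
    by near: n; apply: p_large; rewrite addr_ge0// divr_ge0// ltW.
  have Ke : 0 < K / e by rewrite divr_gt0.
  rewrite /= sub0r normrN ger0_norm; last by rewrite divr_ge0//; lra.
  rewrite ler_pdivrMr; last lra.
  rewrite -ler_pdivrMl// mulrC; lra.
Unshelve. all: by end_near.
Qed.
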